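(* Let $m,b,c_1,c_2\ge1$ be integers with $b$ dividing $m$. Let $\bar{Q},\bar{K},\bar{V}\in\mathbb{R}^{m\times c_1}$ and $\tilde{Q},\tilde{K},\tilde{V}\in\mathbb{R}^{m\times c_2}$. Let $U_m\in\mathbb{R}^{m\times m}$ be the all-ones matrix and $Z=I_b\otimes U_{m/b}\in\mathbb{R}^{m\times m}$. Write $\bar{q}_{i_1}$ and $\bar{k}_{i_2}$ for the $i_1$-th row of $\bar{Q}$ and the $i_2$-th row of $\bar{K}$, with $j$-th entries $\bar{q}_{i_1j}$, $\bar{k}_{i_2j}$, and let $\mathfrak{M}>0$ and $\mathscr{M}>0$ be respectively the maximum and the minimum of $\exp\left(\bar{q}_{i_1}\bar{k}_{i_2}^{\top}+0.5-(\bar{q}_{i_1j}+\bar{k}_{i_2j})\right)$ over $1\le i_1,i_2\le m$ and $1\le j\le c_1$. Let $\xi\in\{2,F\}$ and let $$E=\left\|\left[\exp(\bar{Q})\exp(\bar{K})^{\top}\bar{V},\ \left(\exp(\tilde{Q}\tilde{K}^{\top})\odot Z\right)\tilde{V}\right]-\left[\exp(\bar{Q}\bar{K}^{\top})\bar{V},\ \exp(\tilde{Q}\tilde{K}^{\top})\tilde{V}\right]\right\|_\xi .$$ Then $$E\le\left\|\exp(\bar{Q})\exp(\bar{K})^{\top}-\exp(\bar{Q}\bar{K}^{\top})\right\|_\xi\|\bar{V}\|_\xi+\left\|\exp(\tilde{Q}\tilde{K}^{\top})\odot Z-\exp(\tilde{Q}\tilde{K}^{\top})\right\|_\xi\|\tilde{V}\|_\xi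 .$$ Moreover, if $\left|\frac{c_1}{\mathscr{M}\exp(-0.5)}-1\right|\ge\left|\frac{c_1}{\mathfrak{M}\exp(-0.5)}-1\right|$, then $$E\le\left|\frac{c_1}{\mathscr{M}\exp(-0.5)}-1\right|\left\|\exp(\bar{Q}\bar{K}^{\top})\right\|_\xi\|\bar{V}\|_\xi+\|Z-U_m\|_\xi\left\|\exp(\tilde{Q}\tilde{K}^{\top})\right\|_\xi\|\tilde{V}\|_\xi,$$ and if $\left|\frac{c_1}{\mathscr{M}\exp(-0.5)}-1\right|<\left|\frac{c_1}{\mathfrak{M}\exp(-0.5)}-1\right|$, then $$E\le\left|\frac{c_1}{\mathfrak{M}\exp(-0.5)}-1\right|\left\|\exp(\bar{Q}\bar{K}^{\top})\right\|_\xi\|\bar{V}\|_\xi+\|Z-U_m\|_\xi\left\|\exp(\tilde{Q}\tilde{K}^{\top})\right\|_\xi\|\tilde{V}\|_\xi .$$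
   Context: The function $\exp$ applied to a matrix acts entrywise (it is not the matrix exponential). $\odot$ is the Hadamard (entrywise) product, $\otimes$ the Kronecker product, $I_b$ the $b\times b$ identity matrix, $U_{n}$ the $n\times n$ all-ones matrix, and $[A,B]$ horizontal concatenation. Thus $Z$ is block diagonal with $b$ all-ones blocks of size $m/b$. $\|\cdot\|_2$ is the spectral norm and $\|\cdot\|_F$ the Frobenius norm; $\|\cdot\|_\xi$ denotes either one, the same choice throughout. All vectors are row vectors. *)

(* Defs.v *)
From HB Require Import structures.
From mathcomp Require Import all_boot all_order all_algebra.
From mathcomp Require Import mxtens.
From mathcomp Require Import all_classical all_reals all_analysis.

Set Implicit Arguments.
Unset Strict Implicit.
Unset Printing Implicit Defensive.

Import Order.TTheory GRing.Theory Num.Theory.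
Local Open Scope classical_set_scope.
Local Open Scope ring_scope.

Section Norms.
Context {R : realType}.

Definition frobenius_norm m n (A : 'M[R]_(m, n)) : R :=
  Num.sqrt (\sum_(i < m) \sum_(j < n) A i j ^+ 2).

(* The operator norm induced by the Euclidean norms; on a column vector the
   Frobenius norm is the Euclidean norm. The set is nonempty and bounded, so
   [sup] is not its default value. *)
Definition spectral_norm m n (A : 'M[R]_(m, n)) : R :=
  sup [set frobenius_norm (A *m x) |
       x in [set x : 'cV[R]_n | frobenius_norm x <= 1]].

End Norms.

Variant norm_kind := Spectral | Frobenius.

Definition mxnorm (R : realType) (xi : norm_kind) m n (A : 'M[R]_(m, n)) : R :=
  match xi with
  | Spectral => spectral_norm A
  | Frobenius => frobenius_norm A
  end.

Definition hadamard (R : realType) m n (A B : 'M[R]_(m, n)) : 'M[R]_(m, n) :=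
  map2_mx *%R A B.

Definition mxexp (R : realType) m n (A : 'M[R]_(m, n)) : 'M[R]_(m, n) :=
  map_mx expR A.

Definition all_ones (R : realType) n : 'M[R]_n := const_mx 1.

Lemma mul_divn_dvd b m : (b %| m)%N -> (b * (m %/ b) = m)%N.
Proof. by move=> bm; rewrite mulnC divnK. Qed.

(* The Kronecker product has size b * (m %/ b), hence the cast to m. *)
Definition block_ones (R : realType) m b (bm : (b %| m)%N) : 'M[R]_m :=
  castmx (mul_divn_dvd bm, mul_divn_dvd bm)
    ((1%:M : 'M[R]_b) *t all_ones R (m %/ b)).

Definition exp_ratios (R : realType) m c (Q K : 'M[R]_(m, c)) : set R :=
  [set t | exists (i1 i2 : 'I_m) (j : 'I_c),
     t = expR ((row i1 Q *m (row i2 K)^T) 0 0 + 2^-1 - (Q i1 j + K i2 j))].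

Definition is_maximum (R : realType) (S : set R) (M : R) := S M /\ ubound S M.
Definition is_minimum (R : realType) (S : set R) (M : R) := S M /\ lbound S M.

(* Main.v *)
(* Both norms xi satisfy four properties: they are submultiplicative, the norm
   of [X, Y] is at most the sum of the norms of X and Y, every entry of A is at
   most the norm of A in absolute value, and |A| <= c B entrywise implies
   norm A <= c norm B. The first two give the first bound. For the other ones,
   write t_j for the ratio exp(q k^T + 1/2 - (q_j + k_j)); then
     sum_j exp(q_j + k_j) = exp(q k^T) * sum_j 1 / (t_j exp(-1/2)),
   and the last sum lies between c1 / (maxM exp(-1/2)) and
   c1 / (minM exp(-1/2)), so that the difference of the two kernels is
   entrywise dominated by a multiple of exp(Qbar Kbar^T). Likewise,
   exp(Qtil Ktil^T) o (Z - U) (Hadamard product) is entrywise dominated by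
   norm (Z - U) times the positive matrix exp(Qtil Ktil^T). *)
Require Import Defs.
From mathcomp Require Import all_boot all_order all_algebra.
From mathcomp Require Import mxtens.
From mathcomp Require Import all_classical all_reals all_analysis.
From mathcomp Require Import ring lra.

Set Implicit Arguments.
Unset Strict Implicit.
Unset Printing Implicit Defensive.

Import Order.TTheory GRing.Theory Num.Theory.
Local Open Scope ring_scope.

(** Lagrange's identity: the double sum of the squares [(f i * g j - f j * g i) ^+ 2] is nonnegative
    and is twice the difference of the two sides. *)
Lemma cauchy_schwarz_sum (R : realFieldType) (I : finType) (f g : I -> R) :
  (\sum_i f i * g i) ^+ 2 <= (\sum_i f i ^+ 2) * (\sum_i g i ^+ 2).
Proof.
have H : 0 <= \sum_i \sum_j (f i * g j - f j * g i) ^+ 2.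
  by apply: sumr_ge0 => i _; apply: sumr_ge0 => j _; exact: sqr_ge0.
have E : \sum_i \sum_j (f i * g j - f j * g i) ^+ 2 =
    (\sum_i f i ^+ 2) * (\sum_i g i ^+ 2)
    + (\sum_i g i ^+ 2) * (\sum_i f i ^+ 2)
    - 2 * ((\sum_i f i * g i) * (\sum_i f i * g i)).
  rewrite !big_distrlr /= mulr_sumr -big_split -sumrB /=.
  apply: eq_bigr => i _; rewrite mulr_sumr -big_split -sumrB /=.
  by apply: eq_bigr => j _; ring.
by move: H; rewrite E expr2; lra.
Qed.

(** * Frobenius norm: norm axioms, products, concatenation, domination *)

Section FrobeniusNorm.
Variable R : realType.

Lemma frobenius_norm_ge0 m n (A : 'M[R]_(m, n)) : 0 <= frobenius_norm A.
Proof. exact: sqrtr_ge0. Qed.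

Lemma sqr_frobenius_norm m n (A : 'M[R]_(m, n)) :
  frobenius_norm A ^+ 2 = \sum_i \sum_j A i j ^+ 2.
Proof.
by rewrite sqr_sqrtr// sumr_ge0// => i _; rewrite sumr_ge0// => j _;
  exact: sqr_ge0.
Qed.

Lemma frobenius_norm_le m n (A : 'M[R]_(m, n)) c : 0 <= c ->
  (frobenius_norm A <= c) = (\sum_i \sum_j A i j ^+ 2 <= c ^+ 2).
Proof.
move=> c0; rewrite -sqr_frobenius_norm.
by rewrite ler_pXn2r// nnegrE frobenius_norm_ge0.
Qed.

Lemma le_frobenius_norm m n (A B : 'M[R]_(m, n)) :
  (forall i j, `|A i j| <= `|B i j|) -> frobenius_norm A <= frobenius_norm B.
Proof.
move=> AB; rewrite frobenius_norm_le ?frobenius_norm_ge0// sqr_frobenius_norm.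
apply: ler_sum => i _; apply: ler_sum => j _.
by rewrite -real_normK ?num_real// -[leRHS]real_normK ?num_real// ler_pXn2r//
  nnegrE normr_ge0.
Qed.

Lemma frobenius_normZ m n c (A : 'M[R]_(m, n)) :
  frobenius_norm (c *: A) = `|c| * frobenius_norm A.
Proof.
apply/eqP; rewrite -(@eqrXn2 _ 2)// ?mulr_ge0 ?frobenius_norm_ge0//.
rewrite exprMn real_normK ?num_real// !sqr_frobenius_norm mulr_sumr.
apply/eqP; apply: eq_bigr => i _; rewrite mulr_sumr; apply: eq_bigr => j _.
by rewrite mxE exprMn.
Qed.

Lemma frobenius_norm0 m n : frobenius_norm (0 : 'M[R]_(m, n)) = 0.
Proof. by rewrite -(scale0r 0) frobenius_normZ normr0 mul0r. Qed.

Lemma frobenius_norm_entry m n (A : 'M[R]_(m, n)) i j :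
  `|A i j| <= frobenius_norm A.
Proof.
rewrite -(@ler_pXn2r _ 2)// ?nnegrE ?frobenius_norm_ge0//.
rewrite real_normK ?num_real// sqr_frobenius_norm.
rewrite (bigD1 i)//= (bigD1 j)//= -addrA lerDl addr_ge0//.
  by apply: sumr_ge0 => k _; exact: sqr_ge0.
by apply: sumr_ge0 => k _; apply: sumr_ge0 => l _; exact: sqr_ge0.
Qed.

Lemma frobenius_normD m n (A B : 'M[R]_(m, n)) :
  frobenius_norm (A + B) <= frobenius_norm A + frobenius_norm B.
Proof.
have [A0 B0] := (frobenius_norm_ge0 A, frobenius_norm_ge0 B).
rewrite frobenius_norm_le ?addr_ge0//.
have -> : \sum_i \sum_j (A + B) i j ^+ 2 =
    frobenius_norm A ^+ 2 + frobenius_norm B ^+ 2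
    + 2 * \sum_i \sum_j A i j * B i j.
  rewrite !sqr_frobenius_norm mulr_sumr -!big_split /=; apply: eq_bigr => i _.
  rewrite mulr_sumr -!big_split /=; apply: eq_bigr => j _.
  by rewrite mxE; ring.
suff : \sum_i \sum_j A i j * B i j <= frobenius_norm A * frobenius_norm B.
  by rewrite sqrrD mulr2n; lra.
apply: (le_trans (ler_norm _)).
rewrite -(@ler_pXn2r _ 2)// ?nnegrE ?mulr_ge0//.
(* Double sums become single sums over pairs of indices, so Cauchy-Schwarz bounds the cross term. *)
rewrite real_normK ?num_real// exprMn !sqr_frobenius_norm !pair_bigA /=.
exact: cauchy_schwarz_sum.
Qed.

(** Cauchy-Schwarz applies to each entry of the product, a row of [A] against a column of [B]; the
    sum for [B] is first reordered by columns. *)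
Lemma frobenius_normM m n p (A : 'M[R]_(m, n)) (B : 'M[R]_(n, p)) :
  frobenius_norm (A *m B) <= frobenius_norm A * frobenius_norm B.
Proof.
rewrite frobenius_norm_le ?mulr_ge0 ?frobenius_norm_ge0//.
rewrite exprMn !sqr_frobenius_norm [X in _ <= _ * X]exchange_big.
rewrite big_distrlr /=; apply: ler_sum => i _; apply: ler_sum => k _.
by rewrite mxE; exact: cauchy_schwarz_sum.
Qed.

Lemma sqr_frobenius_norm_row_mx m n1 n2 (A : 'M[R]_(m, n1)) (B : 'M[R]_(m, n2)) :
  frobenius_norm (row_mx A B) ^+ 2 = frobenius_norm A ^+ 2 + frobenius_norm B ^+ 2.
Proof.
rewrite !sqr_frobenius_norm -big_split; apply: eq_bigr => i _ /=.
rewrite big_split_ord /=.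
by congr (_ + _); apply: eq_bigr => j _; rewrite ?row_mxEl ?row_mxEr.
Qed.

Lemma sqr_frobenius_norm_col_mx m1 m2 n (A : 'M[R]_(m1, n)) (B : 'M[R]_(m2, n)) :
  frobenius_norm (col_mx A B) ^+ 2 = frobenius_norm A ^+ 2 + frobenius_norm B ^+ 2.
Proof.
rewrite !sqr_frobenius_norm big_split_ord /=.
by congr (_ + _); apply: eq_bigr => i _; apply: eq_bigr => j _;
  rewrite ?col_mxEu ?col_mxEd.
Qed.

Lemma frobenius_norm_row_mx m n1 n2 (A : 'M[R]_(m, n1)) (B : 'M[R]_(m, n2)) :
  frobenius_norm (row_mx A B) <= frobenius_norm A + frobenius_norm B.
Proof.
have [A0 B0] := (frobenius_norm_ge0 A, frobenius_norm_ge0 B).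
rewrite -(@ler_pXn2r _ 2)// ?nnegrE ?addr_ge0 ?frobenius_norm_ge0//.
by rewrite sqr_frobenius_norm_row_mx sqrrD mulr2n; nra.
Qed.

Lemma frobenius_norm_dominated m n (A B : 'M[R]_(m, n)) c : 0 <= c ->
  (forall i j, `|A i j| <= c * B i j) ->
  frobenius_norm A <= c * frobenius_norm B.
Proof.
move=> c0 AB; rewrite -[X in X * _](ger0_norm c0) -frobenius_normZ.
apply: le_frobenius_norm => i j; rewrite mxE.
exact: le_trans (ler_norm _).
Qed.

End FrobeniusNorm.

(** * Spectral norm: the same properties, through the action on vectors *)

Section SpectralNorm.
Variable R : realType.
Local Open Scope classical_set_scope.

Lemma frobenius_norm_mul_le_spectral m n (A : 'M[R]_(m, n)) (x : 'cV[R]_n) :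
  frobenius_norm x <= 1 -> frobenius_norm (A *m x) <= spectral_norm A.
Proof.
move=> x1; apply: ub_le_sup; last by exists x.
(* The Frobenius norm bounds the set, so [sup] is a true upper bound. *)
exists (frobenius_norm A) => _ [y /= y1 <-].
apply: le_trans (frobenius_normM _ _) _.
by rewrite ler_piMr ?frobenius_norm_ge0.
Qed.

Lemma spectral_norm_le m n (A : 'M[R]_(m, n)) c :
  (forall x : 'cV[R]_n, frobenius_norm x <= 1 -> frobenius_norm (A *m x) <= c) ->
  spectral_norm A <= c.
Proof.
move=> Ac; apply: ge_sup; last by move=> _ [x /= x1 <-]; exact: Ac.
by exists (frobenius_norm (A *m (0 : 'cV_n))), 0; rewrite //= frobenius_norm0.
Qed.

Lemma spectral_norm_ge0 m n (A : 'M[R]_(m, n)) : 0 <= spectral_norm A.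
Proof.
apply: le_trans (frobenius_norm_mul_le_spectral A (x := 0) _).
  exact: frobenius_norm_ge0.
by rewrite frobenius_norm0.
Qed.

Lemma frobenius_norm_mul_spectral m n (A : 'M[R]_(m, n)) (x : 'cV[R]_n) :
  frobenius_norm (A *m x) <= spectral_norm A * frobenius_norm x.
Proof.
have [x0|x0] := eqVneq (frobenius_norm x) 0.
  (* A vector of norm 0 cannot be normalised, but here both sides vanish. *)
  by apply: le_trans (frobenius_normM _ _) _; rewrite x0 !mulr0.
have xp : 0 < frobenius_norm x by rewrite lt_def x0 frobenius_norm_ge0.
rewrite -ler_pdivrMr// mulrC -[X in X * _]gtr0_norm ?invr_gt0//.
rewrite -frobenius_normZ scalemxAr; apply: frobenius_norm_mul_le_spectral.
by rewrite frobenius_normZ gtr0_norm ?invr_gt0// mulVf.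
Qed.

(** The entry is a coordinate of the image under [A] of a standard basis vector, which has norm
    1. *)
Lemma spectral_norm_entry m n (A : 'M[R]_(m, n)) i j :
  `|A i j| <= spectral_norm A.
Proof.
have -> : A i j = (A *m delta_mx j 0) i (0 : 'I_1) by rewrite -colE mxE.
apply: le_trans (frobenius_norm_entry _ _ _) _.
apply: frobenius_norm_mul_le_spectral; rewrite frobenius_norm_le//.
rewrite (bigD1 j)//= big_ord1 mxE !eqxx big1 ?addr0// => k kj.
by rewrite big_ord1 mxE (negbTE kj) expr0n.
Qed.

Lemma spectral_normM m n p (A : 'M[R]_(m, n)) (B : 'M[R]_(n, p)) :
  spectral_norm (A *m B) <= spectral_norm A * spectral_norm B.
Proof.
apply: spectral_norm_le => x x1; rewrite -mulmxA.
apply: le_trans (frobenius_norm_mul_spectral _ _) _.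
by rewrite ler_wpM2l ?spectral_norm_ge0// frobenius_norm_mul_le_spectral.
Qed.

(** Cut a vector of the unit ball into two blocks: their squared norms add up to at most 1, so each
    block lies in its own unit ball. *)
Lemma spectral_norm_row_mx m n1 n2 (A : 'M[R]_(m, n1)) (B : 'M[R]_(m, n2)) :
  spectral_norm (row_mx A B) <= spectral_norm A + spectral_norm B.
Proof.
apply: spectral_norm_le => x; rewrite -[x]vsubmxK => x1.
have : frobenius_norm (col_mx (usubmx x) (dsubmx x)) ^+ 2 <= 1.
  by rewrite expr_le1 ?frobenius_norm_ge0.
rewrite sqr_frobenius_norm_col_mx => {}x1.
rewrite mul_row_col; apply: le_trans (frobenius_normD _ _) _.
have [u0 v0] := (frobenius_norm_ge0 (usubmx x), frobenius_norm_ge0 (dsubmx x)).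
by apply: lerD; apply: frobenius_norm_mul_le_spectral; nra.
Qed.

(** Passing from [x] to its entrywise absolute value [y] stays in the unit ball, and [A *m x] is
    entrywise dominated by [c] times [B *m y]. *)
Lemma spectral_norm_dominated m n (A B : 'M[R]_(m, n)) c : 0 <= c ->
  (forall i j, `|A i j| <= c * B i j) ->
  spectral_norm A <= c * spectral_norm B.
Proof.
move=> c0 AB; apply: spectral_norm_le => x x1.
pose y := map_mx Num.norm x.
have y1 : frobenius_norm y <= 1.
  apply: le_trans x1; apply: le_frobenius_norm => i j.
  by rewrite mxE normr_id.
apply: (@le_trans _ _ (c * frobenius_norm (B *m y))); last first.
  by rewrite ler_wpM2l// frobenius_norm_mul_le_spectral.
apply: frobenius_norm_dominated => // i j; rewrite !mxE mulr_sumr.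
apply: le_trans (ler_norm_sum _ _ _) _; apply: ler_sum => k _.
by rewrite normrM mxE mulrA ler_wpM2r.
Qed.

End SpectralNorm.

(** * Properties shared by both norms *)

Section MxNorm.
Variables (R : realType) (xi : norm_kind).

Lemma mxnorm_ge0 m n (A : 'M[R]_(m, n)) : 0 <= mxnorm xi A.
Proof. by case: xi; [exact: spectral_norm_ge0|exact: frobenius_norm_ge0]. Qed.

Lemma mxnorm_entry m n (A : 'M[R]_(m, n)) i j : `|A i j| <= mxnorm xi A.
Proof. by case: xi; [exact: spectral_norm_entry|exact: frobenius_norm_entry]. Qed.

Lemma mxnormM m n p (A : 'M[R]_(m, n)) (B : 'M[R]_(n, p)) :
  mxnorm xi (A *m B) <= mxnorm xi A * mxnorm xi B.
Proof. by case: xi; [exact: spectral_normM|exact: frobenius_normM]. Qed.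

Lemma mxnorm_row_mx m n1 n2 (A : 'M[R]_(m, n1)) (B : 'M[R]_(m, n2)) :
  mxnorm xi (row_mx A B) <= mxnorm xi A + mxnorm xi B.
Proof. by case: xi; [exact: spectral_norm_row_mx|exact: frobenius_norm_row_mx]. Qed.

Lemma mxnorm_dominated m n (A B : 'M[R]_(m, n)) c : 0 <= c ->
  (forall i j, `|A i j| <= c * B i j) -> mxnorm xi A <= c * mxnorm xi B.
Proof.
by case: xi; [exact: spectral_norm_dominated|exact: frobenius_norm_dominated].
Qed.

Lemma mxnorm_hadamard m n (A B : 'M[R]_(m, n)) : (forall i j, 0 <= A i j) ->
  mxnorm xi (hadamard A B) <= mxnorm xi B * mxnorm xi A.
Proof.
move=> A0; apply: mxnorm_dominated => [|i j]; first exact: mxnorm_ge0.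
by rewrite mxE normrM mulrC (ger0_norm (A0 i j)) ler_wpM2r// mxnorm_entry.
Qed.

End MxNorm.

Lemma hadamard_sub_self (R : realType) n (A B : 'M[R]_n) :
  hadamard A B - A = hadamard A (B - all_ones R n).
Proof. by apply/matrixP => i j; rewrite !mxE mulrBr mulr1. Qed.

(** * Comparison of the two exponential kernels *)

Section KernelApproximation.
Variables (R : realType) (m c : nat) (Q K : 'M[R]_(m, c)) (maxM minM : R).
Hypotheses (maxMP : is_maximum (exp_ratios Q K) maxM)
  (minMP : is_minimum (exp_ratios Q K) minM).

Lemma exp_kernel_bounds i1 i2 :
  c%:R / (maxM * expR (- 2^-1)) * mxexp (Q *m K^T) i1 i2
    <= (mxexp Q *m (mxexp K)^T) i1 i2
    <= c%:R / (minM * expR (- 2^-1)) * mxexp (Q *m K^T) i1 i2.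
Proof.
have [[_ maxub] [[a1 [a2 [a3 minE]]] minlb]] := (maxMP, minMP).
have min0 : 0 < minM by rewrite minE expR_gt0.
set e := mxexp (Q *m K^T) i1 i2.
have e0 : 0 < e by rewrite /e mxE expR_gt0.
pose t j := expR ((row i1 Q *m (row i2 K)^T) 0 0 + 2^-1 - (Q i1 j + K i2 j)).
have t_in j : exp_ratios Q K (t j) by exists i1, i2, j.
have t0 j : 0 < t j by exact: expR_gt0.
have max0 : 0 < maxM.
  by apply: lt_le_trans min0 _; apply: minlb; case: maxMP.
(* The shift 1/2 cancels in [t j * expR (- 2^-1)], leaving the exponential of the inner product
   minus [Q i1 j + K i2 j]; dividing [e] by it gives the [j]-th term of the kernel product. *)
have -> : (mxexp Q *m (mxexp K)^T) i1 i2 =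
    \sum_j (t j * expR (- 2^-1))^-1 * e.
  rewrite mxE; apply: eq_bigr => j _.
  rewrite /e !mxE -!expRD -expRN -expRD; congr expR.
  rewrite !mxE (eq_bigr (fun k => Q i1 k * K^T k i2)).
    by move=> *; lra.
  by move=> k _; rewrite !mxE.
have sum_const (s : R) :
    c%:R / (s * expR (- 2^-1)) * e = \sum_(j < c) (s * expR (- 2^-1))^-1 * e.
  by rewrite sumr_const card_ord -mulrA mulr_natl.
have pos (s : R) : 0 < s -> s * expR (- 2^-1) \is Num.pos.
  by move=> s0; rewrite posrE mulr_gt0 ?expR_gt0.
(* Both bounds are now sums of [c] equal terms, compared term by term; inversion reverses the order,
   so [maxM] yields the lower bound. *)
rewrite !sum_const; apply/andP; split; apply: ler_sum => j _;
  rewrite (ler_wpM2r (ltW e0))// lef_pV2 ?pos// ler_pM2r ?expR_gt0//.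
- exact: maxub.
- exact: minlb.
Qed.

(** Each entry of the kernel product lies between [v * e] and [u * e], where [u] and [v] are both
    within [r] of 1, so it differs from [e] by at most [r * e]. Keeping [r] free serves both cases
    of the theorem. *)
Lemma mxnorm_exp_kernel_sub xi r :
  `|c%:R / (minM * expR (- 2^-1)) - 1| <= r ->
  `|c%:R / (maxM * expR (- 2^-1)) - 1| <= r ->
  mxnorm xi (mxexp Q *m (mxexp K)^T - mxexp (Q *m K^T))
    <= r * mxnorm xi (mxexp (Q *m K^T)).
Proof.
move=> rmin rmax; apply: mxnorm_dominated => [|i j].
  exact: le_trans (normr_ge0 _) rmin.
move: (exp_kernel_bounds i j) rmin rmax.
set u := c%:R / (minM * _); set v := c%:R / (maxM * _).
set S := (_ *m _) i j; set e := mxexp _ i j => /andP[lo hi].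
have e0 : 0 < e by rewrite /e mxE expR_gt0.
have -> : (mxexp Q *m (mxexp K)^T - mxexp (Q *m K^T)) i j = S - e.
  by rewrite [LHS]mxE [X in _ + X]mxE.
rewrite !ler_norml => /andP[u1 u2] /andP[v1 v2].
by apply/andP; split; nra.
Qed.

End KernelApproximation.

Theorem mainTheorem3 (R : realType) (m b c1 c2 : nat)
    (m_ge1 : (1 <= m)%N) (b_ge1 : (1 <= b)%N)
    (c1_ge1 : (1 <= c1)%N) (c2_ge1 : (1 <= c2)%N)
    (b_dvd_m : (b %| m)%N)
    (Qbar Kbar Vbar : 'M[R]_(m, c1)) (Qtil Ktil Vtil : 'M[R]_(m, c2))
    (maxM minM : R)
    (maxMP : is_maximum (exp_ratios Qbar Kbar) maxM)
    (minMP : is_minimum (exp_ratios Qbar Kbar) minM)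
    (xi : norm_kind) :
  let U := all_ones R m in
  let Z := block_ones R b_dvd_m in
  let E := mxnorm xi
    (row_mx (mxexp Qbar *m (mxexp Kbar)^T *m Vbar)
            (hadamard (mxexp (Qtil *m Ktil^T)) Z *m Vtil)
     - row_mx (mxexp (Qbar *m Kbar^T) *m Vbar)
              (mxexp (Qtil *m Ktil^T) *m Vtil)) in
  let err_min := `| c1%:R / (minM * expR (- 2^-1)) - 1 | in
  let err_max := `| c1%:R / (maxM * expR (- 2^-1)) - 1 | in
  [/\ E <= mxnorm xi (mxexp Qbar *m (mxexp Kbar)^T - mxexp (Qbar *m Kbar^T))
             * mxnorm xi Vbar
           + mxnorm xi (hadamard (mxexp (Qtil *m Ktil^T)) Z
                        - mxexp (Qtil *m Ktil^T)) * mxnorm xi Vtil,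
      err_max <= err_min ->
        E <= err_min * mxnorm xi (mxexp (Qbar *m Kbar^T)) * mxnorm xi Vbar
             + mxnorm xi (Z - U) * mxnorm xi (mxexp (Qtil *m Ktil^T))
               * mxnorm xi Vtil
    & err_min < err_max ->
        E <= err_max * mxnorm xi (mxexp (Qbar *m Kbar^T)) * mxnorm xi Vbar
             + mxnorm xi (Z - U) * mxnorm xi (mxexp (Qtil *m Ktil^T))
               * mxnorm xi Vtil ].

Proof.
move=> U Z E err_min err_max.
have E_le : E <= mxnorm xi (mxexp Qbar *m (mxexp Kbar)^T
                             - mxexp (Qbar *m Kbar^T)) * mxnorm xi Vbar
    + mxnorm xi (hadamard (mxexp (Qtil *m Ktil^T)) Z - mxexp (Qtil *m Ktil^T))
      * mxnorm xi Vtil.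
  (* The difference of concatenations is taken blockwise, and [Vbar] and [Vtil] factor out on the
     right. *)
  rewrite /E opp_row_mx add_row_mx -!mulmxBl.
  apply: le_trans (mxnorm_row_mx _ _ _) _.
  by apply: lerD; exact: mxnormM.
have mask_le : mxnorm xi (hadamard (mxexp (Qtil *m Ktil^T)) Z
                          - mxexp (Qtil *m Ktil^T))
    <= mxnorm xi (Z - U) * mxnorm xi (mxexp (Qtil *m Ktil^T)).
  rewrite hadamard_sub_self.
  by apply: mxnorm_hadamard => i j; rewrite mxE expR_ge0.
(* The two remaining bounds are the cases where [r] is the larger of [err_min] and [err_max]. *)
have E_le_err r : err_min <= r -> err_max <= r ->
    E <= r * mxnorm xi (mxexp (Qbar *m Kbar^T)) * mxnorm xi Vbar
      + mxnorm xi (Z - U) * mxnorm xi (mxexp (Qtil *m Ktil^T)) * mxnorm xi Vtil.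
  move=> rmin rmax; apply: le_trans E_le _.
  apply: lerD; rewrite ler_wpM2r ?mxnorm_ge0//.
  exact: (mxnorm_exp_kernel_sub maxMP minMP).
by split=> // [max_le|/ltW min_le]; apply: E_le_err.
Qed.
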